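(* Let $D=(V,E)$ be a weakly connected finite directed graph and let $e\in E$ be any edge. Then the polynomial $h^*_{D/e}$ is coefficientwise smaller than or equal to $h^*_{D}$, where $D/e$ denotes the digraph obtained by contracting the edge $e$.
   Context: Directed graphs may have loops and multiple edges. For an edge $e$ with tail $t$ and head $h$, let $\mathbf{x}_e\in\mathbb{R}^V$ be the vector with coordinate $1$ at $h$, coordinate $-1$ at $t$, and $0$ elsewhere (so $\mathbf{x}_e=\mathbf{0}$ for a loop). The extended root polytope of $D$ is $\tilde{\mathcal{Q}}_D=\operatorname{conv}(\{\mathbf{0}\}\cup\{\mathbf{x}_e\mid e\in E\})\subset\mathbb{R}^V$, a lattice polytope with respect to $\mathbb{Z}^V$. For a $d$-dimensional lattice polytope $Q\subset\mathbb{R}^n$, its $h^*$-polynomial $\sum_{i=0}^d h^*_i t^i$ is defined by $\sum_{i=0}^d h^*_i t^i=(1-t)^{d+1}\sum_{k\ge 0}|(kQ)\cap\mathbb{Z}^n|\,t^k$. We write $h^*_D$ for the $h^*$-polynomial of $\tilde{\mathcal{Q}}_D$. A digraph is weakly connected if its underlying undirected graph is connected. *)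

(* Defs.v *)
From HB Require Import structures.
From mathcomp Require Import all_boot all_order all_algebra.
From mathcomp Require Import finmap.
From mathcomp Require Import boolp classical_sets cardinality reals.

Set Implicit Arguments.
Unset Strict Implicit.
Unset Printing Implicit Defensive.

Import Order.TTheory GRing.Theory Num.Theory.

Local Open Scope classical_set_scope.
Local Open Scope ring_scope.

Record digraph := Digraph {
  vertex : finType;
  edge : finType;
  tail : edge -> vertex;
  head : edge -> vertex
}.

Definition adjacent (D : digraph) : rel (vertex D) := fun x y =>
  [exists f : edge D, ((tail f == x) && (head f == y))
                   || ((tail f == y) && (head f == x))].

Definition weakly_connected (D : digraph) : Prop :=
  (0 < #|vertex D|)%N /\ forall x y : vertex D, connect (@adjacent D) x y.

(* The quotient of the vertex set identifying [head e] with [tail e] is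
   represented by removing [head e] and redirecting it to [tail e]; when e is a
   loop every vertex is kept, so that contracting a loop deletes it. Edges
   parallel or antiparallel to e become loops. *)
Section Contraction.
Variables (D : digraph) (e : edge D).

Definition contract_vertex : finType :=
  {x : vertex D | (x != head e) || (x == tail e)}.

Definition contract_edge : finType := {f : edge D | f != e}.

Definition contract_fun (x : vertex D) : vertex D :=
  if x == head e then tail e else x.

Lemma contract_fun_subproof (x : vertex D) :
  (contract_fun x != head e) || (contract_fun x == tail e).
Proof. by rewrite /contract_fun; case: ifP => [_|->]; rewrite ?eqxx ?orbT. Qed.

Definition contract_proj (x : vertex D) : contract_vertex :=
  exist _ (contract_fun x) (contract_fun_subproof x).

Definition contract : digraph :=
  @Digraph contract_vertex contract_edge
    (fun f => contract_proj (tail (val f)))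
    (fun f => contract_proj (head (val f))).

End Contraction.

(* [R^o] rather than [R] gives the space its canonical vectType structure. *)
Notation "''R[' R ]^ V" := {ffun V -> R^o}
  (at level 8, R at level 200, V at level 1, format "''R[' R ]^ V").

Definition conv_hull (R : realType) (U : lmodType R) (A : set U) : set U :=
  [set x | exists (n : nat) (l : 'I_n -> R) (a : 'I_n -> U),
     [/\ forall i, 0 <= l i, \sum_(i < n) l i = 1, forall i, A (a i)
       & x = \sum_(i < n) l i *: a i]].

(* The largest m such that A contains m + 1 affinely independent points
   p, p + s_0, .., p + s_(m-1). *)
Definition affine_dim (R : realType) (U : vectType R) (A : set U) : nat :=
  \max_(m < (\dim {:U}).+1 |
    `[< exists (p : U) (s : m.-tuple U),
          [/\ A p, forall i, A (p + tnth s i) & free s] >]) m.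

Section Ehrhart.
Variables (R : realType) (V : finType).

Definition lattice : set 'R[R]^V := [set x | forall v, (x v : R) \is a Num.int].

Definition dilate (k : nat) (Q : set 'R[R]^V) : set 'R[R]^V :=
  [set k%:R *: x | x in Q].

(* [fset_set] is the empty set on infinite sets, which is irrelevant for the
   bounded sets considered here. *)
Definition ehrhart (Q : set 'R[R]^V) (k : nat) : nat :=
  #|` fset_set (dilate k Q `&` lattice)|.

Definition hstar_coef (Q : set 'R[R]^V) (i : nat) : int :=
  \sum_(j < i.+1)
    ((1 - 'X : {poly int}) ^+ (affine_dim Q).+1)`_j * (ehrhart Q (i - j))%:Z.

(* [hstar_coef Q i] is the coefficient of t^i in the formal power series
   (1 - t)^(d + 1) * \sum_(k >= 0) (ehrhart Q k) t^k with d = dim Q; for a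
   lattice polytope Q it vanishes for i > d, by Ehrhart's theorem. *)
Definition hstar (Q : set 'R[R]^V) : {poly int} :=
  \poly_(i < (affine_dim Q).+1) hstar_coef Q i.

End Ehrhart.

Arguments lattice : clear implicits.

Section RootPolytope.
Variables (R : realType) (D : digraph).

Definition edge_vector (f : edge D) : 'R[R]^(vertex D) :=
  [ffun v => (v == head f)%:R - (v == tail f)%:R].

Definition extended_root_polytope : set 'R[R]^(vertex D) :=
  conv_hull ([set 0] `|` range edge_vector).

Definition hstar_digraph : {poly int} := hstar extended_root_polytope.

End RootPolytope.

Arguments extended_root_polytope : clear implicits.

(* Main.v *)
(* Let x_f be the vector of an edge f.  Because the incidence matrix is totally
   unimodular, the lattice points of k Q_D are the sums of at most k vectors
   x_f, i.e. the boundaries [bd n] of flows n in N^E with at most k edges.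
   Refine the number of edges to a generic weight w, and perturb lattice points
   in the direction of a generic positive combination q of the x_f: the support
   of the w-minimal flow with boundary N x + q (N large) is a spanning tree s,
   and x = bd n for a unique n in N^s which is positive on
   Z(s) = {f in s : the s-coordinate of q at f is negative}.  This is a
   half-open decomposition of the cone of D into unimodular cones, so h*_i is
   the number of trees s that occur and have |Z(s)| = i.  Which trees occur is
   decided by the sign of w on the circuits of D.  If w prefers e among the
   flows with equally many edges and q is dominated by x_e, then adding e to a
   tree of D/e gives a tree of D with the same |Z|, so the count for D/e is at
   most the count for D. *)
From mathcomp Require Import all_boot all_order all_algebra.
From mathcomp Require Import finmap boolp classical_sets cardinality reals.
From mathcomp Require Import zify ring lra.
Require Import Defs.

Set Implicit Arguments.
Unset Strict Implicit.
Unset Printing Implicit Defensive.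

Import Order.TTheory GRing.Theory Num.Theory.
Local Open Scope ring_scope.

(** * Boundaries and circuits *)

Lemma sum_delta (F : pzRingType) (I : finType) (P : pred I) (a : I) :
  \sum_(v | P v) (v == a)%:R = (P a)%:R :> F.
Proof.
case Pa: (P a); last by rewrite big1 // => v Pv; case: eqP => // va; rewrite -va Pv in Pa.
by rewrite (bigD1 a) //= eqxx big1 ?addr0 // => v /andP[_ /negbTE->].
Qed.

Section Circuits.
Variable D : digraph.
Local Notation V := (vertex D).
Local Notation E := (edge D).

Definition incidence (F : pzRingType) (f : E) (v : V) : F :=
  (v == head f)%:R - (v == tail f)%:R.

Definition bd (F : pzRingType) (z : E -> F) (v : V) : F :=
  \sum_f z f * incidence F f v.

Section Boundary.
Variable F : comPzRingType.
Implicit Types (z : E -> F) (A : {set V}).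

Lemma sum_incidence (P : pred V) f :
  \sum_(v | P v) incidence F f v = (P (head f))%:R - (P (tail f))%:R.
Proof. by rewrite sumrB !sum_delta. Qed.

(** Conservation across a cut: an edge with both ends in [P] or both outside cancels, so only
    crossing edges contribute. *)
Lemma sum_bd (P : pred V) z :
  \sum_(v | P v) bd z v = \sum_f z f * ((P (head f))%:R - (P (tail f))%:R).
Proof.
rewrite exchange_big; apply: eq_bigr => f _.
by rewrite -mulr_sumr sum_incidence.
Qed.

Lemma bdD z z' v : bd (fun f => z f + z' f) v = bd z v + bd z' v.
Proof. by rewrite -big_split; apply: eq_bigr => f _; rewrite mulrDl. Qed.

Lemma bdB z z' v : bd (fun f => z f - z' f) v = bd z v - bd z' v.
Proof. by rewrite -sumrB; apply: eq_bigr => f _; rewrite mulrBl. Qed.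

Lemma bdZ c z v : bd (fun f => c * z f) v = c * bd z v.
Proof. by rewrite mulr_sumr; apply: eq_bigr => f _; rewrite mulrA. Qed.

Lemma bd_single c g v :
  bd (fun f => if f == g then c else 0) v = c * incidence F g v.
Proof.
rewrite /bd (bigD1 g) //= eqxx big1 ?addr0 // => f /negbTE->.
by rewrite mul0r.
Qed.

Lemma bd0 v : bd (fun=> 0 : F) v = 0.
Proof. by rewrite /bd big1 // => f _; rewrite mul0r. Qed.

Lemma eq_bd z z' : z =1 z' -> bd z =1 bd z'.
Proof. by move=> zz v; apply: eq_bigr => f _; rewrite zz. Qed.

End Boundary.

Lemma incidence_intr (F : pzRingType) (f : E) (v : V) :
  incidence F f v = (incidence int f v)%:~R.
Proof. by rewrite /incidence rmorphB /= !rmorph_nat. Qed.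

Lemma bd_intr (F : pzRingType) (z : E -> int) (v : V) :
  bd (fun f => (z f)%:~R : F) v = (bd z v)%:~R.
Proof.
rewrite rmorph_sum /=; apply: eq_bigr => f _.
by rewrite rmorphM /= -incidence_intr.
Qed.

(** These are all circulations with values in -1, 0, 1, so the zero circulation and edge-disjoint
    unions of cycles count as circuits. *)
Definition circuit (c : E -> int) :=
  (forall f, `|c f| <= 1) /\ (forall v, bd c v = 0).

(** Both implications apply where [z] vanishes, so the support of [c] lies in that of [z]. *)
Definition conformal (F : numDomainType) (c : E -> int) (z : E -> F) :=
  forall f, (0 <= z f -> 0 <= c f) /\ (z f <= 0 -> c f <= 0).

Lemma circuitN c : circuit c -> circuit (fun f => - c f).
Proof.
case=> c1 c0; split=> [f|v]; first by rewrite normrN.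
have := bdZ (-1) c v; rewrite c0 mulr0 => <-.
by apply: eq_bd => f; rewrite mulN1r.
Qed.

(** Direct every edge of the support along the sign of [z]. Conservation yields a simple directed
    path from the end of [f] back to its start, and [f] closes it to a cycle. *)
Lemma circuit_through (F : realDomainType) (z : E -> F) (f : E) :
  (forall v, bd z v = 0) -> z f != 0 ->
  exists c, [/\ circuit c, conformal c z & c f != 0].
Proof.
move=> z0 zf.
pose src g := if 0 < z g then tail g else head g.
pose dst g := if 0 < z g then head g else tail g.
pose arc u v := [exists g, [&& z g != 0, src g == u & dst g == v]].
have sgz_inc g v : z g != 0 ->
    sgz (z g) * incidence _ g v = (v == dst g)%:R - (v == src g)%:R.
  rewrite /incidence /src /dst; case: (ltgtP (z g) 0) => // zg _.
    by rewrite ltr0_sgz // mulN1r opprB.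
  by rewrite gtr0_sgz // mul1r.
(* Otherwise the set reachable from [dst f] would receive the flow of [f] and lose none,
   contradicting conservation. *)
have src_reach : connect arc (dst f) (src f).
  pose reach := connect arc (dst f).
  apply/negPn/negP; rewrite -/(reach _) => nsrc.
  have clA g : z g != 0 -> reach (src g) ->
      reach (dst g).
    move=> zg h; apply: connect_trans h (connect1 _).
    by apply/existsP; exists g; rewrite zg !eqxx.
  have := sum_bd reach z.
  rewrite big1 // (bigD1 f) //= => /esym/eqP.
  rewrite gt_eqF // ltr_wpDr //.
    apply: sumr_ge0 => g _; move: (clA g); rewrite /src /dst.
    case: (ltgtP (z g) 0) => [zg /(_ isT)|zg /(_ isT)|-> _]; last by rewrite mul0r.
      move=> h; apply: mulr_le0; first exact: ltW.
      case: (reach (head g)) h => [->//|_]; first by rewrite subrr.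
      by rewrite sub0r oppr_le0 ler0n.
    move=> h; apply: mulr_ge0; first exact: ltW.
    case: (reach (tail g)) h => [->//|_]; first by rewrite subrr.
    by rewrite subr0 ler0n.
  have: reach (dst f) := connect0 arc (dst f).
  move: nsrc; rewrite /src /dst.
  case: (ltgtP (z f) 0) zf => // zf _ /negbTE-> ->.
    by rewrite sub0r mulrN1 oppr_gt0.
  by rewrite subr0 mulr1.
(* Recording the sources of the arcs used shows that a repetition-free path uses no edge twice,
   which keeps the values in -1, 0, 1. *)
have path_flow p u : path arc u p -> uniq (u :: p) -> exists c : E -> int,
   [/\ forall g, c g = 0 \/ c g = sgz (z g),
       forall v, bd c v = (v == last u p)%:R - (v == u)%:R
     & forall g, c g != 0 -> src g \in belast u p].
  elim: p u => [|w p IH] u /=.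
    by move=> _ _; exists (fun=> 0); split=> [g|v|g]; [left|rewrite bd0 subrr|rewrite eqxx].
  case/andP=> /existsP[g /and3P[zg /eqP sg /eqP dg]] /IH{}IH /andP[unp /IH[c [c1 c2 c3]]].
  exists (fun h => c h + if h == g then sgz (z g) else 0); split=> [h|v|h].
  - case: eqP => [->|_]; last by rewrite addr0.
    right; case: (eqVneq (c g) 0) => [->|/c3]; first by rewrite add0r.
    by rewrite sg => /mem_belast; rewrite (negPf unp).
  - by rewrite bdD c2 bd_single sgz_inc // sg dg; ring.
  - case: (eqVneq h g) => [->|_]; first by rewrite sg mem_head.
    by rewrite addr0 inE => /c3->; rewrite orbT.
case/connectP: src_reach => p0 /shortenP[p pp up _] lastp {p0}.
have [c [c1 c2 c3]] := path_flow p _ pp up.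
(* The path ends at [src f], and [belast] omits this last vertex, so the path does not use [f]. *)
have cf : c f = 0.
  apply/eqP/negPn/negP => /c3; rewrite lastp.
  by move: up; rewrite lastI rcons_uniq => /andP[/negP].
exists (fun h => c h + if h == f then sgz (z f) else 0).
have c4 h : let x := c h + (if h == f then sgz (z f) else 0) in
    x = 0 \/ x = sgz (z h).
  by case: eqP => [->|_] /=; rewrite ?addr0 // cf add0r; right.
split.
- split=> [g|v].
    case: (c4 g) => /= ->; first by rewrite normr0.
    by case: sgzP.
  by rewrite bdD c2 bd_single sgz_inc // lastp; ring.
- move=> g; case: (c4 g) => /= ->; first by [].
  by rewrite sgz_ge0 sgz_le0.
- by rewrite eqxx cf add0r sgz_eq0.
Qed.

End Circuits.

(** * Flows of minimal weight *)

Section Optimality.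
Variable D : digraph.
Local Notation V := (vertex D).
Local Notation E := (edge D).

(** Conformal decomposition: subtracting from [z] the largest multiple of a conformal circuit that
    flips no sign empties at least one edge, and the functional is nonnegative on the part
    removed. *)
Lemma conformal_functional_ge0 (F : realDomainType) (w : E -> int) (z : E -> F) :
  (forall v, bd z v = 0) ->
  (forall c, circuit c -> conformal c z -> 0 <= \sum_f w f * c f) ->
  0 <= \sum_f (w f)%:~R * z f.
Proof.
have [n] := ubnP #|[pred f | z f != 0]|.
elim: n z => // n IH z; rewrite ltnS => zn z0 wz.
have [/existsP[f zf]|/existsPn zf] := boolP [exists f, z f != 0]; last first.
  by rewrite big1 // => f _; move/negPn/eqP: (zf f) => ->; rewrite mulr0.
have [c [cc cz cf]] := circuit_through z0 zf.
have cz0 g : c g != 0 -> z g != 0.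
  apply: contra => /eqP zg; have [] := cz g.
  by rewrite zg lexx eq_le => /(_ isT) -> /(_ isT) ->.
have c3 g : [\/ c g = 0, c g = 1 /\ 0 < z g | c g = -1 /\ z g < 0].
  have [c1 _] := cc; move: (c1 g) (cz g) (cz0 g).
  case: (ltgtP (z g) 0) => [zg|zg|zg] h [h1 h2] h3.
  - have := h2 isT; have [-> _|cg _] := eqVneq (c g) 0; [exact: Or31|].
    by apply: Or33; split=> //; lia.
  - have := h1 isT; have [-> _|cg _] := eqVneq (c g) 0; [exact: Or31|].
    by apply: Or32; split=> //; lia.
  - by apply: Or31; apply/eqP/negPn/negP => /h3.
case: (Order.TotalTheory.arg_minP (fun g => `|z g|) (i0 := f) (P := fun g => c g != 0)) => //.
move=> g cg gmin; set s := `|z g| in gmin.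
have s0 : 0 < s by rewrite normr_gt0 cz0.
pose z' h := z h - s * (c h)%:~R.
have z'0 v : bd z' v = 0.
  by rewrite /z' bdB z0 bdZ bd_intr cc.2 mulr0 subr0.
have z'z h : (0 <= z h -> 0 <= z' h) /\ (z h <= 0 -> z' h <= 0).
  rewrite /z'; have := gmin h; case: (c3 h) => [->|[-> zh]|[-> zh]].
  - by rewrite mulr0 subr0.
  - rewrite gtr0_norm // mulr1 subr_ge0 => /(_ isT) szh.
    by split=> // /le_lt_trans/(_ zh); rewrite ltxx.
  - rewrite ltr0_norm // mulrN1 opprK => /(_ isT) szh; split; last by lra.
    by move=> /(lt_le_trans zh); rewrite ltxx.
have wc : 0 <= \sum_f w f * c f by apply: wz.
have -> : \sum_f (w f)%:~R * z f =
    \sum_f (w f)%:~R * z' f + s * (\sum_f w f * c f)%:~R.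
  rewrite rmorph_sum mulr_sumr -big_split; apply: eq_bigr => h _ /=.
  by rewrite /z' rmorphM /=; ring.
apply: addr_ge0; last by rewrite mulr_ge0 ?ler0z // ltW.
apply: IH => //.
  apply: leq_trans zn; apply/proper_card/fintype.properP; split.
    apply/fintype.subsetP => h; rewrite !inE; apply: contra => /eqP zh.
    by have [] := z'z h; rewrite zh lexx eq_le => /(_ isT) -> /(_ isT) ->.
  exists g; rewrite !inE ?cz0 // negbK /z' /s.
  case: (c3 g) cg => [->//|[-> zg]|[-> zg]] _.
    by rewrite gtr0_norm // mulr1 subrr.
  by rewrite ltr0_norm // mulrNN mulr1 subrr.
move=> c' cc' c'z'; apply: wz => // h; have [h1 h2] := z'z h; have [h3 h4] := c'z' h.
by split; auto.
Qed.

(** The linear programming criterion for a flow that is positive exactly on [s]: the circuits tested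
    are the directions in which such a flow can move and stay nonnegative. *)
Definition optimal (w : E -> int) (s : {set E}) :=
  forall c, circuit c -> (forall f, f \notin s -> 0 <= c f) ->
    0 <= \sum_f w f * c f.

Lemma optimal_ge0 (F : realDomainType) (w : E -> int) (s : {set E}) (z : E -> F) :
  optimal w s -> (forall v, bd z v = 0) -> (forall f, f \notin s -> 0 <= z f) ->
  0 <= \sum_f (w f)%:~R * z f.
Proof.
move=> ws z0 zs; apply: conformal_functional_ge0 => // c cc cz.
by apply: ws => // f /zs /(cz f).1.
Qed.

(** Costs are natural numbers, so a cheapest flow exists. A circuit of negative weight could be
    added to it, since its entries are at least -1 and are negative only where the flow is at least
    1. *)
Lemma optimal_flow (w n : E -> int) :
  (forall f, 0 <= w f) -> (forall f, 0 <= n f) ->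
  exists m : E -> int, [/\ forall f, 0 <= m f, bd m =1 bd n
    & optimal w [set f | m f != 0]].
Proof.
move=> w0 n0.
pose P k := `[< exists m : E -> int, [/\ forall f, 0 <= m f, bd m =1 bd n
    & \sum_f w f * m f = k%:Z] >].
have cost0 (m : E -> int) : (forall f, 0 <= m f) ->
    \sum_f w f * m f = (absz (\sum_f w f * m f))%:Z.
  by move=> m0; rewrite gez0_abs // sumr_ge0 // => f _; rewrite mulr_ge0.
have exP : exists k, P k.
  exists (absz (\sum_f w f * n f)); apply/asboolP; exists n; split=> //.
  exact: cost0.
have [k /asboolP[m [m0 mn mk]] kmin] := ex_minnP exP.
exists m; split=> // c cc cs; rewrite leNgt; apply/negP => wc.
pose m' f := m f + c f.
have m'0 f : 0 <= m' f.
  rewrite /m'; have := cs f; rewrite inE; have := cc.1 f; have := m0 f; lia.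
have := kmin (absz (\sum_f w f * m' f)); rewrite /P => kk.
have: (k <= absz (\sum_f w f * m' f)%R)%N.
  apply: kk; apply/asboolP; exists m'; split=> //; last exact: cost0.
  by move=> v; rewrite bdD cc.2 addr0.
have : \sum_f w f * m' f = k%:Z + \sum_f w f * c f.
  by rewrite -mk -big_split; apply: eq_bigr => f _; rewrite mulrDr.
have := cost0 m' m'0; lia.
Qed.

End Optimality.

(** * Bases and the half-open decomposition *)

Lemma lt_mul_add_eq0 (N a b : int) : `|b| < N -> N * a + b = 0 -> b = 0.
Proof. by case: (ltgtP a 0) => [h|h|->]; nia. Qed.

Section Bases.
Variable D : digraph.
Local Notation V := (vertex D).
Local Notation E := (edge D).
Implicit Types (s : {set E}) (f : E).

Definition supported (F : nmodType) (s : {set E}) (z : E -> F) :=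
  forall f, f \notin s -> z f = 0.

(** The coefficients are integral, so an independent spanning set is a basis of the lattice
    generated by the edge vectors; this makes the cones unimodular. *)
Definition spanned (s : {set E}) (y : V -> int) :=
  exists2 z, supported s z & bd z =1 y.

Definition spanning (s : {set E}) := forall f, spanned s (incidence int f).

Definition independent (s : {set E}) :=
  forall z : E -> int, supported s z -> (forall v, bd z v = 0) ->
    forall f, z f = 0.

Lemma spannedD s y y' : spanned s y -> spanned s y' ->
  spanned s (fun v => y v + y' v).
Proof.
case=> [z zs zy] [z' zs' zy']; exists (fun f => z f + z' f).
  by move=> f fs; rewrite zs // zs' // addr0.
by move=> v; rewrite bdD zy zy'.
Qed.

Lemma spannedZ s c y : spanned s y -> spanned s (fun v => c * y v).
Proof.
case=> [z zs zy]; exists (fun f => c * z f).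
  by move=> f fs; rewrite zs // mulr0.
by move=> v; rewrite bdZ zy.
Qed.

Lemma eq_spanned s y y' : y =1 y' -> spanned s y -> spanned s y'.
Proof. by move=> yy [z zs zy]; exists z => // v; rewrite zy yy. Qed.

Lemma spanned_sum s (I : finType) (c : I -> int) (y : I -> V -> int) :
  (forall i, spanned s (y i)) -> spanned s (fun v => \sum_i c i * y i v).
Proof.
move=> ys; have /choice[z zP] : forall i, exists z,
    supported s z /\ bd z =1 y i.
  by move=> i; case: (ys i) => z; exists z.
exists (fun f => \sum_i c i * z i f).
  by move=> f fs; rewrite big1 // => i _; rewrite (zP i).1 // mulr0.
move=> v; rewrite /bd; under eq_bigr do rewrite mulr_suml.
rewrite exchange_big; apply: eq_bigr => i _ /=.
rewrite -(zP i).2 /bd mulr_sumr; apply: eq_bigr => f _.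
by rewrite mulrA.
Qed.

Lemma spanned_incidence s f : f \in s -> spanned s (incidence int f).
Proof.
move=> fs; exists (fun g => if g == f then 1 else 0).
  by move=> g; case: eqP => // ->; rewrite fs.
by move=> v; rewrite bd_single mul1r.
Qed.

Lemma spanning_bd s (n : E -> int) : spanning s -> spanned s (bd n).
Proof. exact: spanned_sum. Qed.

Lemma independent_inj s (z z' : E -> int) : independent s ->
  supported s z -> supported s z' -> bd z =1 bd z' -> z =1 z'.
Proof.
move=> si zs zs' zz' f; apply/eqP; rewrite -subr_eq0; apply/eqP.
apply: (si (fun f => z f - z' f)) => [g gs|v]; first by rewrite zs // zs' // subrr.
by rewrite bdB zz' subrr.
Qed.

(* The vertices joined to u by edges of s; the span formulation makes paths
   unnecessary. *)
Definition component (s : {set E}) (u : V) : pred V := fun v =>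
  `[< spanned s (fun x => (x == v)%:R - (x == u)%:R) >].

Lemma component_refl s u : component s u u.
Proof.
apply/asboolP; exists (fun=> 0) => // v.
by rewrite bd0 subrr.
Qed.

Lemma component_closed s u f : f \in s ->
  component s u (head f) = component s u (tail f).
Proof.
move=> /spanned_incidence fs; apply/asboolP/asboolP => h.
  apply: eq_spanned (spannedD h (spannedZ (-1) fs)) => v.
  by rewrite /incidence; ring.
by apply: eq_spanned (spannedD h fs) => v; rewrite /incidence; ring.
Qed.

Lemma sum_bd_closed (F : comPzRingType) (s : {set E}) (P : pred V) (z : E -> F) :
  supported s z -> (forall f, f \in s -> P (head f) = P (tail f)) ->
  \sum_(v | P v) bd z v = 0.
Proof.
move=> zs Ps; rewrite sum_bd big1 // => f _.
have [/Ps->|/zs->] := boolP (f \in s); first by rewrite subrr mulr0.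
by rewrite mul0r.
Qed.

(** Take for [P] the component of [head f] after removing [f] from [s]. It misses [tail f], since
    otherwise [f] would close a relation inside [s]; hence [f] is the only edge of [s] across [P],
    and the cut sum reads off its coordinate. *)
Lemma fundamental_cut s f : independent s -> f \in s -> exists P : pred V,
  [/\ P (head f), ~~ P (tail f)
    & forall z : E -> int, supported s z -> \sum_(v | P v) bd z v = z f].
Proof.
move=> si fs; pose P := component (s :\ f) (head f).
have Ph : P (head f) by exact: component_refl.
have Pt : ~~ P (tail f).
  apply/negP => /asboolP[z zs zf].
  have: z f + 1 = 0; last by rewrite zs ?add0r // !inE eqxx.
  pose z' g := z g + if g == f then 1 else 0.
  have -> : z f + 1 = z' f by rewrite /z' eqxx.
  apply: (si z') => [g gs|v].
    by rewrite /z' zs ?inE ?negb_and ?gs ?orbT // ifN ?addr0 //; apply: contraNneq gs => ->.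
  by rewrite bdD zf bd_single /incidence; ring.
exists P; split=> // z zs; rewrite sum_bd (bigD1 f) //= Ph (negbTE Pt) subr0 mulr1.
rewrite big1 ?addr0 // => g gf; have [gs|/zs->] := boolP (g \in s); last by rewrite mul0r.
by rewrite /P (@component_closed (s :\ f) _ g) ?subrr ?mulr0 // !inE gf.
Qed.

(** Connectivity phrased by cuts, the form in which the cut sums of the shift use it. *)
Definition edge_connected :=
  forall P : pred V, (exists v, P v) -> (forall f, P (head f) = P (tail f)) ->
    forall v, P v.

(** Each difference of a unit vector at [v] and the one at [u] is a boundary; weighting these by
    [y v] leaves total weight zero at [u]. *)
Lemma edge_connected_bd (u : V) (y : V -> int) : edge_connected ->
  \sum_v y v = 0 -> exists z : E -> int, bd z =1 y.
Proof.
move=> conn y0; pose s := [set: E].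
have uv v : component s u v.
  apply: conn; first by exists u; exact: component_refl.
  by move=> f; apply: component_closed; rewrite inE.
have [z _ zy] := spanned_sum y (fun v => asboolW (uv v)).
exists z => x; rewrite zy.
under eq_bigr do rewrite mulrBr.
rewrite sumrB -mulr_suml y0 mul0r subr0 (bigD1 x) //= eqxx mulr1 big1 ?addr0 //.
by move=> v /negbTE vx; rewrite eq_sym vx mulr0.
Qed.

End Bases.

(** * The half-open decomposition *)

Section HalfOpen.
Variable D : digraph.
Local Notation V := (vertex D).
Local Notation E := (edge D).
Implicit Types (s : {set E}) (f : E).

(** Genericity of the weight makes minimal flows unique. Coordinates with respect to a basis are cut
    sums, so [shift_cut] keeps the shift direction off every wall of the cones. *)
Record generic_data := GenericData {
  weight : E -> int;
  shift : E -> int;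
  weight_ge0 : forall f, 0 <= weight f;
  weight_neq0 : forall c, circuit c -> \sum_f weight f * c f = 0 ->
    forall f, c f = 0;
  weight_refine : forall c, circuit c -> \sum_f c f < 0 ->
    \sum_f weight f * c f < 0;
  shift_ge0 : forall f, 0 <= shift f;
  shift_cut : forall P : pred V, (exists v, P v) ->
    (exists v, ~~ P v) -> \sum_(v | P v) bd shift v != 0 }.

Variable G : generic_data.
Local Notation w := (weight G).
Local Notation q := (bd (shift G)).

Definition bases : {set {set E}} :=
  [set s | `[< optimal w s /\ spanning s >]].

Lemma basesP s : reflect (optimal w s /\ spanning s) (s \in bases).
Proof. by rewrite inE; apply: asboolP. Qed.

(** A relation inside [s] contains a circuit [c] supported on [s]. Optimality applies to [c] and to
    its negative, so the weight of [c] is zero, against genericity. *)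
Lemma optimal_independent s : optimal w s -> independent s.
Proof.
move=> ws z zs z0 f; apply/eqP/negPn/negP => zf.
have [c [cc cz cf]] := circuit_through z0 zf.
have cs g : g \notin s -> c g = 0.
  move=> gs; have [] := cz g.
  by rewrite zs // lexx => /(_ isT) h1 /(_ isT) h2; apply/le_anti/andP.
case/negP: cf; apply/eqP; apply: (@weight_neq0 G) => //.
apply/le_anti/andP; split; last by apply: ws => // g /cs->.
rewrite -oppr_ge0 -sumrN.
have := ws _ (circuitN cc); under eq_bigr do rewrite mulrN.
by apply=> g /cs->; rewrite oppr0.
Qed.

Lemma bases_independent s : s \in bases -> independent s.
Proof. by case/basesP=> /optimal_independent. Qed.

(** The expansion of [q] in the edges of [s]; the default 0 is not reached on [bases], which span
    [q]. *)
Definition coords (s : {set E}) : E -> int :=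
  if pselect (exists2 r, supported s r & bd r =1 q) is left h
  then sval (cid2 h) else fun=> 0.

(** The facets [n f = 0] through which a small move along [q] leaves the cone of [s]; deleting them
    makes the cones disjoint. *)
Definition excluded (s : {set E}) : {set E} := [set f in s | coords s f < 0].

Lemma coordsP s : s \in bases -> supported s (coords s) /\ bd (coords s) =1 q.
Proof.
case/basesP=> _ ss; rewrite /coords; case: pselect => [h|[]].
  by case: cid2.
exact: spanning_bd.
Qed.

(** Large enough to exceed every cut sum of [q], hence every coordinate of [q] in a basis. *)
Let N : int := 1 + \sum_v `|q v|.

Let N0 : 0 < N.
Proof. by rewrite /N ltr_wpDr // sumr_ge0. Qed.

Lemma cut_bound (P : pred V) : `|\sum_(v | P v) q v| < N.
Proof.
apply: le_lt_trans (ler_norm_sum _ _ _) _.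
rewrite /N (bigID P xpredT) /=.
by rewrite addrCA ltrDl ltr_wpDr // sumr_ge0.
Qed.

(** By the fundamental cut of [f], the coordinate is itself a cut sum of [q]. *)
Lemma coords_bound s f : s \in bases -> f \in s ->
  `|coords s f| < N /\ coords s f != 0.
Proof.
move=> sb fs; have [rs rq] := coordsP sb.
have [P [Ph Pt Pz]] := fundamental_cut (bases_independent sb) fs.
rewrite -(Pz _ rs); under eq_bigr do rewrite rq.
split; first exact: cut_bound.
by apply: (@shift_cut G); [exists (head f) | exists (tail f)].
Qed.

(** The weight refines the number of edges, so minimal weight implies fewest edges; this later
    bounds the dilation factor of a lattice point. *)
Lemma unit_optimal s : optimal w s -> optimal (fun=> 1) s.
Proof.
move=> ws c cc cs; rewrite leNgt; apply/negP.
under eq_bigr do rewrite mul1r.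
by move=> /(weight_refine G cc); rewrite ltNge ws.
Qed.

(** If the support did not join the ends of [f], no flow of [m] would cross the component of
    [tail f]. The cut sum of [q] there would be a multiple of [N] smaller than [N], hence zero,
    against genericity. *)
Lemma shifted_support_spanning (m x : E -> int) :
  (forall v, bd m v = N * bd x v + q v) -> spanning [set f | m f != 0].
Proof.
move=> mx f; set s := [set f | _]; pose P := component s (tail f).
have: P (head f).
  apply/negPn/negP => nP.
  have: \sum_(v | P v) bd m v = 0.
    apply: (@sum_bd_closed _ _ s) => [g|g]; last exact: component_closed.
    by rewrite inE negbK => /eqP.
  under eq_bigr do rewrite mx.
  rewrite big_split -mulr_sumr /=.
  move/(lt_mul_add_eq0 (cut_bound P)).
  apply/eqP; apply: (@shift_cut G); last by exists (head f).
  by exists (tail f); exact: component_refl.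
by move/asboolP.
Qed.

(** Take the minimal flow with boundary [N * bd x + q]. On its support [s] it equals
    [N * n + coords s]; being at least 1 there while the coordinates are below [N] in absolute
    value, it forces [n] to be nonnegative, and positive where the coordinate is negative. *)
Lemma half_open_exists (x : E -> int) : (forall f, 0 <= x f) ->
  exists s n, [/\ s \in bases, supported s n, forall f, 0 <= n f,
    forall f, f \in excluded s -> 1 <= n f & bd n =1 bd x].
Proof.
move=> x0.
have y0 f : 0 <= N * x f + shift G f.
  by rewrite addr_ge0 ?shift_ge0 // mulr_ge0 // ltW.
have [m [m0 mb ms]] := optimal_flow (@weight_ge0 G) y0.
have mx v : bd m v = N * bd x v + q v by rewrite mb bdD bdZ.
set s := [set f | m f != 0] in ms.
have sb : s \in bases.
  by apply/basesP; split=> //; apply: shifted_support_spanning mx.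
have [n ns nx] := spanning_bd x (shifted_support_spanning mx).
have [rs rq] := coordsP sb.
have mE : m =1 (fun f => N * n f + coords s f).
  apply: (independent_inj (bases_independent sb)) => [f|f fs|v].
  - by rewrite inE negbK => /eqP.
  - by rewrite ns // rs // mulr0.
  - by rewrite bdD bdZ nx rq mx.
have mn f : f \in s -> 1 <= N * n f + coords s f /\ `|coords s f| < N.
  move=> fs; split; last by case: (coords_bound sb fs).
  by rewrite -mE; move: fs (m0 f); rewrite inE; lia.
exists s, n; split=> // f.
  have [/mn[h1 h2]|/ns->//] := boolP (f \in s); nia.
by rewrite inE => /andP[/mn[h1 h2] h3]; nia.
Qed.

(** The flows [N * n + coords s] and [N * n' + coords s'] are positive exactly on [s] and [s'] and
    have the same boundary. For a circuit conformal to their difference, optimality of [s'] bounds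
    its weight below by zero and optimality of [s] bounds it above, so genericity makes it
    vanish. *)
Lemma half_open_unique s s' (n n' : E -> int) : s \in bases -> s' \in bases ->
  supported s n -> supported s' n' ->
  (forall f, 0 <= n f) -> (forall f, 0 <= n' f) ->
  (forall f, f \in excluded s -> 1 <= n f) ->
  (forall f, f \in excluded s' -> 1 <= n' f) ->
  bd n =1 bd n' -> s = s' /\ n =1 n'.
Proof.
pose m s (n : E -> int) f : int := N * n f + coords s f.
have mpos t k : t \in bases -> supported t k -> (forall f, 0 <= k f) ->
    (forall f, f \in excluded t -> 1 <= k f) ->
    forall f, if f \in t then 0 < m t k f else m t k f == 0.
  move=> tb tk k0 kZ f; rewrite /m; case: ifPn => ft; last first.
    by rewrite tk // (coordsP tb).1 // mulr0.
  have [h1 h2] := coords_bound tb ft; move: (kZ f) (k0 f); rewrite inE ft /=.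
  case: (ltgtP (coords t f) 0) h2 => // h _; last by nia.
  by move=> /(_ isT); nia.
move=> sb sb' sn sn' n0 n0' nZ nZ' nn'.
have ms := mpos _ _ sb sn n0 nZ; have ms' := mpos _ _ sb' sn' n0' nZ'.
pose z f : int := m s n f - m s' n' f.
have zb v : bd z v = 0.
  by rewrite bdB !bdD !bdZ nn' (coordsP sb).2 (coordsP sb').2 subrr.
have z0 f : z f = 0.
  apply/eqP/negPn/negP => zf.
  have [c [cc cz cf]] := circuit_through zb zf.
  case/negP: cf; apply/eqP; apply: (@weight_neq0 G) => //.
  apply/le_anti/andP; split.
    rewrite -oppr_ge0 -sumrN.
    have [/(_ _ (circuitN cc)) + _] := basesP _ sb; under eq_bigr do rewrite mulrN.
    apply=> g gs; rewrite oppr_ge0; apply: (cz g).2.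
    by move: (ms g) (ms' g); rewrite /z (negbTE gs); case: ifP; lia.
  have [/(_ _ cc) + _] := basesP _ sb'.
  apply=> g gs; apply: (cz g).1.
  by move: (ms g) (ms' g); rewrite /z (negbTE gs); case: ifP; lia.
have mm f : m s n f = m s' n' f by apply/eqP; rewrite -subr_eq0; apply/eqP/z0.
have ss' : s = s'.
  apply/setP => f; move: (ms f) (ms' f); rewrite mm.
  by case: ifP; case: ifP => //; lia.
split=> // f; have := mm f; rewrite /m ss' => /addIr.
exact: (mulfI (lt0r_neq0 N0)).
Qed.

End HalfOpen.

(** * Lattice points of the root polytope *)

Section IntegralFlows.
Variable D : digraph.
Local Notation V := (vertex D).
Local Notation E := (edge D).

(* A negative entry of z can be repaired along a circuit conformal to l - z,
   which creates no new negative entries because l is nonnegative. *)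
Lemma integral_flow (F : realDomainType) (l : E -> F) (z : E -> int) :
  (forall f, 0 <= l f) -> (forall v, bd l v = (bd z v)%:~R) ->
  exists2 n : E -> int, (forall f, 0 <= n f) & bd n =1 bd z.
Proof.
move=> l0; pose neg (z : E -> int) f := if z f < 0 then absz (z f) else 0%N.
have [k] := ubnP (\sum_f neg z f)%N.
elim: k z => // k IH z; rewrite ltnS => zk lz.
have [/existsP[f zf]|/existsPn zf] := boolP [exists f, z f < 0]; last first.
  by exists z => // f; rewrite leNgt zf.
pose y f : F := l f - (z f)%:~R.
have y0 v : bd y v = 0 by rewrite bdB bd_intr lz subrr.
have yf : 0 < y f.
  by rewrite subr_gt0 (lt_le_trans _ (l0 f)) // ltrz0.
have [c [[c1 c0] cy cf]] := circuit_through y0 (lt0r_neq0 yf).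
have cfp : 1 <= c f by have := (cy f).1 (ltW yf); move: cf; lia.
have cz g : z g <= 0 -> 0 <= c g.
  by move=> zg; apply: (cy g).1; rewrite subr_ge0 (le_trans _ (l0 g)) // lerz0.
have [|v|n n0 nz] := IH (fun g => z g + c g); first last.
- by exists n => // v; rewrite nz bdD c0 addr0.
- by rewrite bdD c0 addr0.
apply: leq_trans zk; rewrite (bigD1 f) //= [X in (_ < X)%N](bigD1 f) //= -addSn.
apply: leq_add; first by rewrite /neg zf; have := c1 f; case: ifP; lia.
apply: leq_sum => g _; rewrite /neg.
by have := cz g; have := c1 g; case: ifP; case: ifP; lia.
Qed.

End IntegralFlows.

Section Polytope.
Variables (R : realType) (D : digraph).
Local Notation V := (vertex D).
Local Notation E := (edge D).
Local Notation Q := (extended_root_polytope R D).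

Lemma sum_edge_vector (l : E -> R) (v : V) :
  (\sum_f l f *: edge_vector R f) v = bd l v.
Proof.
rewrite sum_ffunE; apply: eq_bigr => f _.
by rewrite !ffunE.
Qed.

Lemma root_polytopeP (x : 'R[R]^V) : Q x <->
  exists l : E -> R, [/\ forall f, 0 <= l f, \sum_f l f <= 1
    & x = \sum_f l f *: edge_vector R f].
Proof.
split=> [[n [l [a [l0 l1 aQ ->]]]]|[l [l0 l1 ->]]].
  (* Each point of the combination is labelled by an edge producing it, or by [None] if it is the
     origin; points with the same label are then merged. *)
  have /choice[g gP] : forall i, exists o : option E,
      a i = oapp (@edge_vector R D) 0 o.
    by move=> i; case: (aQ i) => [->|[f _ <-]]; [exists None | exists (Some f)].
  exists (fun f => \sum_(i | g i == Some f) l i); split.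
  - by move=> f; apply: sumr_ge0.
  - rewrite -l1 (bigID (fun i => g i == None)) /=.
    rewrite -[X in X <= _]add0r; apply: lerD; first by apply: sumr_ge0.
    rewrite le_eqVlt; apply/orP; left; apply/eqP.
    under eq_bigr do rewrite big_mkcond.
    rewrite exchange_big [RHS]big_mkcond; apply: eq_bigr => i _ /=.
    case: (g i) => [h|] /=; last by rewrite big1.
    by rewrite -big_mkcond /= (big_pred1 h) // => f; rewrite eq_sym.
  - under [RHS]eq_bigr do rewrite scaler_suml big_mkcond.
    rewrite exchange_big; apply: eq_bigr => i _ /=; rewrite gP.
    case: (g i) => [h|] /=; last by rewrite scaler0 big1.
    by rewrite -big_mkcond /= (big_pred1 h) // => f; rewrite eq_sym.
(* Index 0 carries the origin and receives the slack [1 - \sum_f l f]; the other indices enumerate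
   the edges. *)
exists #|E|.+1, (fun i => oapp (fun j => l (enum_val j)) (1 - \sum_f l f) (unlift ord0 i)),
  (fun i => oapp (fun j : 'I_#|E| => edge_vector R (enum_val j)) 0 (unlift ord0 i)).
split.
- by move=> i; case: unliftP => [j _|_] //=; rewrite subr_ge0.
- rewrite big_ord_recl unlift_none; under [X in _ + X]eq_bigr do rewrite liftK.
  by rewrite /= -(big_enum_val l) subrK.
- by move=> i; case: unliftP => [j _|_] /=; [right; exists (enum_val j) | left].
- rewrite big_ord_recl unlift_none scaler0 add0r.
  under [RHS]eq_bigr do rewrite liftK.
  by rewrite /= -(big_enum_val (fun f => l f *: edge_vector R f)).
Qed.

End Polytope.

Section LatticePoints.
Variables (R : realType) (D : digraph) (u : vertex D).
Local Notation V := (vertex D).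
Local Notation E := (edge D).
Local Notation Q := (extended_root_polytope R D).
Hypothesis conn : edge_connected D.
Variable G : generic_data D.

(** A point of the dilate is a real flow of total at most [k]. Connectivity and circuit repair make
    it an integral flow, the decomposition places it in one cone, and its expansion there has the
    fewest edges, hence at most [k]. *)
Lemma lattice_pointsP (k : nat) (x : 'R[R]^V) :
  (dilate k Q `&` lattice R V)%classic x <->
  exists s (n : E -> int),
    [/\ s \in bases G, supported s n, forall f, 0 <= n f,
        forall f, f \in excluded G s -> 1 <= n f
      & \sum_f n f <= k /\ x = [ffun v => (bd n v)%:~R]].
Proof.
split=> [[[_ /root_polytopeP[l [l0 l1 ->]] <-] xint]|].
  pose l' f := k%:R * l f.
  have xE v : (k%:R *: \sum_f l f *: edge_vector R f : 'R[R]^V) v = bd l' v.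
    by rewrite bdZ -sum_edge_vector ffunE.
  have /choice[y xP] : forall v, exists m : int, bd l' v = m%:~R.
    by move=> v; have := xint v; rewrite xE => /intrP.
  have [|z zy] := @edge_connected_bd D u y conn.
    apply/eqP; rewrite -(eqr_int R) rmorph_sum /=.
    under eq_bigr do rewrite -xP.
    by rewrite sum_bd big1 // => f _; rewrite subrr mulr0.
  have l'0 f : 0 <= l' f by rewrite mulr_ge0.
  have [|n0 n0p n0z] := @integral_flow D R l' z l'0; first by move=> v; rewrite xP zy.
  have [s [n [sb ns np nZ nn0]]] := half_open_exists G n0p.
  exists s, n; split=> //; split; last first.
    by apply/ffunP => v; rewrite xE ffunE xP nn0 n0z zy.
  have [sopt _] := basesP _ _ sb.
  (* The two flows have equal boundary and [n] vanishes outside [s], so their difference is a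
     circulation to which optimality for the unit weight applies. *)
  have: 0 <= \sum_f 1%:~R * (l' f - (n f)%:~R).
    apply: (optimal_ge0 (unit_optimal sopt)) => [v|f fs].
      by rewrite bdB bd_intr nn0 n0z zy xP subrr.
    by rewrite ns // subr0.
  under eq_bigr do rewrite mul1r.
  rewrite sumrB subr_ge0 -rmorph_sum /= -(ler_int R) => /le_trans; apply.
  by rewrite -mulr_sumr ler_piMr.
case=> s [n [_ _ n0 _ [nk ->]]]; split; last first.
  by move=> v; rewrite ffunE; apply/intrP; exists (bd n v).
(* The dilate by 0 is treated apart, because the witness for positive [k] divides by [k]. *)
have [k0|k0] := posnP k.
  have nz f : n f = 0.
    apply/le_anti/andP; split=> //; rewrite k0 in nk; apply: le_trans nk.
    by rewrite (bigD1 f) //= lerDl sumr_ge0.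
  exists 0; first by apply/root_polytopeP; exists (fun=> 0); split=> //;
    rewrite big1 // => f _; rewrite scale0r.
  rewrite scaler0; apply/ffunP => v; rewrite !ffunE (eq_bd (z' := fun=> 0)) //.
  by rewrite bd0.
have kn0 : k%:R != 0 :> R by rewrite pnatr_eq0 -lt0n.
exists (\sum_f ((n f)%:~R / k%:R) *: edge_vector R f).
  apply/root_polytopeP; exists (fun f => (n f)%:~R / k%:R); split=> //.
    by move=> f; rewrite divr_ge0 // ler0z.
  by rewrite -mulr_suml ler_pdivrMr ?ltr0n // mul1r -rmorph_sum /= -[k%:R]/(k%:Z%:~R) ler_int.
apply/ffunP => v; rewrite !ffunE sum_edge_vector -bd_intr.
rewrite -[LHS]/(k%:R * bd (fun f => (n f)%:~R / k%:R) v) -bdZ.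
by apply: eq_bd => f; rewrite mulrC divfK.
Qed.

(** A real relation would contain a circuit, which is an integral relation. *)
Lemma real_independent s (l : E -> R) : independent s -> supported s l ->
  (forall v, bd l v = 0) -> forall f, l f = 0.
Proof.
move=> si ls l0 f; apply/eqP/negPn/negP => lf.
have [c [[_ c0] cl cf]] := circuit_through l0 lf.
case/negP: cf; apply/eqP; apply: si => // g gs.
have [] := cl g.
by rewrite ls // lexx => /(_ isT) h1 /(_ isT) h2; apply/le_anti/andP.
Qed.

(** The edge vectors of [s] form a basis of the span of the polytope, and together with the origin
    they are affinely independent points of it. *)
Lemma affine_dim_bases s : s \in bases G -> affine_dim Q = #|s|.
Proof.
move=> sb; pose X := [tuple edge_vector R (enum_val j) | j < #|s|].
have Xi (i : 'I_#|s|) : X`_i = edge_vector R (enum_val i).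
  by rewrite -tnth_nth tnth_mktuple.
have edgeX f : edge_vector R f \in <<X>>%VS.
  have [_ /(_ f)[z zs zf]] := basesP _ _ sb.
  have -> : edge_vector R f = \sum_g (z g)%:~R *: edge_vector R g.
    apply/ffunP => v; rewrite sum_edge_vector bd_intr zf -incidence_intr.
    by rewrite ffunE.
  apply: rpred_sum => g _; have [gs|/zs->] := boolP (g \in s); last first.
    by rewrite scale0r rpred0.
  apply/rpredZ/memv_span; rewrite -(enum_rankK_in gs gs) -Xi.
  by rewrite mem_nth // size_tuple.
have QX x : Q x -> x \in <<X>>%VS.
  by case/root_polytopeP => l [_ _ ->]; apply: rpred_sum => f _; apply: rpredZ.
have Xfree : free X.
  apply/freeP => k; under eq_bigr do rewrite Xi.
  pose l f := \sum_(i < #|s| | enum_val i == f) k i.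
  have ls : supported s l.
    move=> f fs; rewrite /l big_pred0 // => i; apply/eqP => fi.
    by move: fs; rewrite -fi enum_valP.
  have lk i : l (enum_val i) = k i.
    by rewrite /l (big_pred1 i) // => j; rewrite /= (inj_eq enum_val_inj).
  move=> kX i; rewrite -lk.
  apply: (real_independent (bases_independent sb)) => // v.
  rewrite -sum_edge_vector.
  rewrite (bigID (mem s)) /= [X in _ + X]big1 ?addr0; last first.
    by move=> f /ls->; rewrite scale0r.
  rewrite big_enum_val; under eq_bigr do rewrite lk.
  by rewrite kX ffunE.
have Xn : (#|s| < (\dim {:'R[R]^V}).+1)%N.
  by rewrite ltnS -{1}(size_tuple X) -(eqP Xfree) dimvS // subvf.
apply/eqP; rewrite eqn_leq; apply/andP; split.
  apply/bigmax_leqP => m /asboolP[p [t [Qp Qt tfree]]].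
  rewrite -{1}(size_tuple t) -(eqP tfree).
  apply: leq_trans (dimvS _) (leq_trans (dim_span X) _); last by rewrite size_tuple.
  apply/span_subvP => y /tnthP[i ->].
  (* Each direction is a difference of two points of the polytope. *)
  by rewrite -(addrK p (tnth t i)) rpredB ?QX // addrC.
apply: (bigop.bigmax_sup (Ordinal Xn)) => //; apply/asboolP.
exists 0, X; split=> //.
  by apply/root_polytopeP; exists (fun=> 0); split=> //; rewrite big1 // => f _; rewrite scale0r.
move=> i; rewrite add0r tnth_mktuple; apply/root_polytopeP.
exists (fun g => (g == enum_val i)%:R); split=> //.
  by rewrite sum_delta.
rewrite (bigD1 (enum_val i)) //= eqxx scale1r big1 ?addr0 // => g /negbTE->.
by rewrite scale0r.
Qed.

End LatticePoints.

(** * The h*-polynomial *)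

Section HilbertSeries.

(** Power series are handled as polynomials modulo ['X^K]; this is compatibility of that congruence
    with products. *)
Lemma poly_congr_prod (I : finType) (K : nat) (p r : I -> {poly int}) :
  (forall i, exists b, p i = r i + 'X^K * b) ->
  exists b, \prod_i p i = \prod_i r i + 'X^K * b.
Proof.
move=> pr; apply: (big_ind2 (fun x y => exists b, x = y + 'X^K * b)) => //.
  by exists 0; rewrite mulr0 addr0.
move=> x y x' y' [b ->] [b' ->]; exists (y * b' + b * y' + b * 'X^K * b').
by ring.
Qed.

Lemma geometric_poly (K : nat) :
  (1 - 'X) * (\sum_(j < K) 'X^j) = 1 - 'X^K :> {poly int}.
Proof. by rewrite -[1 - 'X]opprB mulNr -subrX1 opprB. Qed.

(** Multiplying by the truncated geometric series turns counting by exact number of edges into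
    counting by at most [k] edges. *)
Lemma coef_geometric (K m k : nat) : (k < K)%N ->
  (((\sum_(j < K) 'X^j) * 'X^m : {poly int})`_k) = (m <= k)%N%:R.
Proof.
move=> kK; rewrite coefMXn ltnNge; case: leqP => //= mk.
rewrite (eq_bigr (fun j : 'I_K => 1 *: 'X^j)); last by move=> j _; rewrite scale1r.
by rewrite -(poly_def K (fun=> 1)) coef_poly (leq_ltn_trans (leq_subr _ _) kK).
Qed.

Variables (D : digraph) (G : generic_data D) (K : nat).
Hypothesis K_gt0 : (0 < K)%N.
Local Notation E := (edge D).
Implicit Types (s : {set E}) (f : E).

(** The coordinates of lattice points of the half-open cone of [s], cut off below [K] so that the
    set is finite. *)
Definition admissible (s : {set E}) (f : E) : pred 'I_K := fun i =>
  if f \notin s then i == 0 :> nat else (f \in excluded G s) ==> (0 < i)%N.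

Definition cone_series (s : {set E}) : {poly int} :=
  \sum_(n in family (admissible s)) 'X^(\sum_f (n f : nat)).

(** The coordinates vary independently, so the series is a product over edges. Modulo ['X^K], an
    edge of [s] contributes the inverse of [1 - 'X], times ['X] if it is excluded. *)
Lemma cone_seriesE s : exists b,
  (1 - 'X) ^+ #|s| * cone_series s = 'X^(#|excluded G s|) + 'X^K * b.
Proof.
have -> : cone_series s = \prod_f \sum_(i | admissible s f i) 'X^(i : 'I_K).
  rewrite bigA_distr_big_dep; apply: eq_bigr => n _.
  by rewrite prodrXr.
have -> : (1 - 'X : {poly int}) ^+ #|s| = \prod_f (if f \in s then 1 - 'X else 1).
  by rewrite -big_mkcond prodr_const.
have -> : 'X^(#|excluded G s|) = \prod_f (if f \in excluded G s then 'X else 1) :> {poly int}.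
  by rewrite -big_mkcond prodr_const.
rewrite -big_split; apply: poly_congr_prod => f /=.
have geo := geometric_poly K.
have [fs|fs] := boolP (f \in s); last first.
  rewrite inE (negbTE fs) /= mul1r; exists 0; rewrite mulr0 addr0.
  rewrite (big_pred1 (Ordinal K_gt0)) // => i.
  by rewrite /admissible fs.
have [fZ|fZ] := boolP (f \in excluded G s); last first.
  exists (-1); rewrite (eq_bigl xpredT); first by rewrite geo; ring.
  by move=> i; rewrite /admissible fs (negbTE fZ).
exists (-1); move: geo; rewrite (bigD1 (Ordinal K_gt0)) //= expr0 => geo.
rewrite (eq_bigl (fun i => i != Ordinal K_gt0)); last first.
  by move=> i; rewrite /admissible fs fZ /= lt0n.
have -> : 'X + 'X^K * (-1) = 1 - 'X^K - (1 - 'X) :> {poly int} by ring.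
by rewrite -geo; ring.
Qed.

(** One factor [1 - 'X] cancels the geometric series and the other [d] cancel the denominators of
    the cones; each basis leaves ['X] to the size of its excluded set, up to terms of degree at
    least [K]. *)
Lemma hilbert_series_coef d i : (i < K)%N -> (forall s, s \in bases G -> #|s| = d) ->
  ((1 - 'X) ^+ d.+1 * ((\sum_(j < K) 'X^j) * \sum_(s in bases G) cone_series s))`_i
  = #|[set s in bases G | #|excluded G s| == i]|%:R.
Proof.
move=> iK sd.
have /choice[b bP] : forall s, exists b : {poly int}, s \in bases G ->
   (1 - 'X) ^+ d * cone_series s = 'X^(#|excluded G s|) + 'X^K * b.
  move=> s; have [b bs] := cone_seriesE s; exists b => /sd <-; exact: bs.
have geo := geometric_poly K.
set S := \sum_(s in _) _; set H := \sum_(j < K) _ in geo *.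
have Sb : (1 - 'X) ^+ d * S =
    \sum_(s in bases G) 'X^(#|excluded G s|) + 'X^K * \sum_(s in bases G) b s.
  by rewrite mulr_sumr mulr_sumr -big_split; apply: eq_bigr => s /bP.
have -> : (1 - 'X) ^+ d.+1 * (H * S) =
   \sum_(s in bases G) 'X^(#|excluded G s|)
   + ((1 - 'X^K) * (\sum_(s in bases G) b s) - \sum_(s in bases G) 'X^(#|excluded G s|)) * 'X^K.
  rewrite exprS; transitivity (((1 - 'X) * H) * ((1 - 'X) ^+ d * S)); first by ring.
  by rewrite geo Sb; ring.
rewrite coefD coefMXn iK addr0 coef_sum.
rewrite -sum1_card natr_sum big_mkcond [RHS]big_mkcond; apply: eq_bigr => s _.
by rewrite finset.in_set coefXn eq_sym; case: (s \in bases G); case: eqP.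
Qed.

End HilbertSeries.

(** * Counting lattice points in dilates *)

Section EhrhartCount.
Variables (R : realType) (D : digraph) (u : vertex D).
Local Notation V := (vertex D).
Local Notation E := (edge D).
Implicit Types (s : {set E}) (f : E).
Local Notation Q := (extended_root_polytope R D).
Hypothesis conn : edge_connected D.
Variable G : generic_data D.

Lemma admissibleP K s (n : {ffun E -> 'I_K}) :
  reflect (supported s (fun f => (n f : nat)%:Z) /\
           forall f, f \in excluded G s -> 1 <= (n f : nat)%:Z)
    (n \in family (admissible G s)).
Proof.
apply: (iffP familyP) => [h|[h1 h2] f].
  split=> f fs; have := h f; rewrite unfold_in /admissible fs; first by move/eqP->.
  by rewrite implyTb; case: ifP => // /negP[]; move: fs; rewrite inE => /andP[].
rewrite unfold_in /admissible; case: ifPn => [/h1[->]//|_].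
by apply/implyP => /h2.
Qed.

(** The map from a basis and an admissible flow to the boundary is injective by uniqueness in the
    decomposition and onto by [lattice_pointsP]. *)
Lemma ehrhart_count K k : (k < K)%N ->
  ehrhart Q k = #|[set p : {set E} * {ffun E -> 'I_K} | [&& p.1 \in bases G,
     p.2 \in family (admissible G p.1) & (\sum_f p.2 f <= k)%N]]|.
Proof.
move=> kK; set P := [set p | _].
pose phi (p : {set E} * {ffun E -> 'I_K}) : 'R[R]^V :=
  [ffun v => (bd (fun f => (p.2 f : nat)%:Z) v)%:~R].
have PE s (n : {ffun E -> 'I_K}) : ((s, n) \in P) =
    [&& s \in bases G, n \in family (admissible G s) & (\sum_f n f <= k)%N].
  by rewrite finset.in_set.
have phi_inj : {in P &, injective phi}.
  move=> [s n] [s' n']; rewrite !PE.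
  move=> /and3P[sb /admissibleP[ns nZ] _] /and3P[sb' /admissibleP[ns' nZ'] _] /ffunP e.
  have [|||-> nn'] := half_open_unique sb sb' ns ns' _ _ nZ nZ' => //.
    by move=> v; have := e v; rewrite !ffunE => /intr_inj.
  by congr pair; apply/ffunP => f; apply/val_inj; case: (nn' f).
rewrite /ehrhart.
have -> : (dilate k Q `&` lattice R V = [set` [fset phi p | p in P]%fset])%classic.
  apply/seteqP; split=> x /=.
    move/(lattice_pointsP u conn G) => [s [n [sb ns n0 nZ [nk ->]]]].
    (* No entry exceeds the total, which is at most [k], so truncation at [K] loses nothing. *)
    have nfk f : (absz (n f) < K)%N.
      apply: leq_ltn_trans kK; rewrite -lez_nat gez0_abs //.
      by apply: le_trans nk; rewrite (bigD1 f) //= lerDl sumr_ge0.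
    pose n' := [ffun f => Ordinal (nfk f)].
    have n'E f : (n' f : nat)%:Z = n f by rewrite ffunE /= gez0_abs.
    apply/imfsetP; exists (s, n') => /=.
      rewrite PE sb /=; apply/andP; split.
        by apply/admissibleP; split=> f; rewrite n'E; [exact: ns | exact: nZ].
      by rewrite -lez_nat -natz natr_sum; under eq_bigr do rewrite natz n'E.
    by apply/ffunP => v; rewrite !ffunE; congr _%:~R; apply: eq_bd => f; rewrite n'E.
  case/imfsetP => [[s n]] /=; rewrite PE => /and3P[sb /admissibleP[ns nZ] nk] ->.
  apply/(lattice_pointsP u conn G).
  exists s, (fun f => (n f : nat)%:Z); split=> //; split=> //.
  by move: nk; rewrite -lez_nat -natz natr_sum; under eq_bigr do rewrite natz.
by rewrite set_fsetK card_in_imfset // -cardE.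
Qed.

Lemma ehrhart_coef K k : (k < K)%N ->
  (ehrhart Q k)%:Z =
  ((\sum_(j < K) 'X^j) * \sum_(s in bases G) cone_series G K s)`_k.
Proof.
move=> kK; rewrite (ehrhart_count kK) mulr_sumr coef_sum -natz -sum1_card.
rewrite natr_sum; under [RHS]eq_bigr do rewrite mulr_sumr coef_sum.
under [RHS]eq_bigr do under eq_bigr do rewrite coef_geometric //.
rewrite [RHS]pair_big_dep /= big_mkcond [RHS]big_mkcond.
apply: eq_bigr => -[s n] _; rewrite finset.in_set /=.
by case: (s \in _); case: (n \in _); case: leqP.
Qed.

Lemma hstar_digraph_coef s i : s \in bases G ->
  (hstar_digraph R D)`_i =
  if (i <= #|s|)%N then #|[set t in bases G | #|excluded G t| == i]|%:R else 0.
Proof.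
move=> sb; rewrite /hstar_digraph coef_poly (affine_dim_bases R sb) ltnS.
case: ifP => // _; rewrite /hstar_coef (affine_dim_bases R sb).
(* Only the dilates up to [i] enter the coefficient, so truncation at [i.+1] suffices. *)
rewrite -(@hilbert_series_coef D G i.+1 _ #|s|) // ?coefM.
  apply: eq_bigr => j _; congr (_ * _); apply: ehrhart_coef.
  by rewrite ltnS leq_subr.
by move=> t tb; rewrite -(affine_dim_bases R tb) (affine_dim_bases R sb).
Qed.

End EhrhartCount.

(** * Lexicographic weights *)

Section LexicographicData.
Variable D : digraph.
Local Notation V := (vertex D).
Local Notation E := (edge D).
Variables (l : E -> int) (rk : E -> nat).
Hypotheses (l1 : forall f, `|l f| <= 1) (rk_inj : injective rk).
Implicit Types c : E -> int.

Definition pow2 f : int := 2 ^+ rk f.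

Lemma pow2_gt0 f : 0 < pow2 f. Proof. exact: exprn_gt0. Qed.

(** At the edge of least rank in the support, all other terms are divisible by the next power of
    two, so the entry there is even, hence zero. *)
Lemma sum_pow2_eq0 c : (forall f, `|c f| <= 1) -> \sum_f pow2 f * c f = 0 ->
  forall f, c f = 0.
Proof.
move=> c1 c0 f0; apply/eqP/negPn/negP => cf0.
case: (arg_minnP rk (i0 := f0) (P := fun f => c f != 0)) => // f cf fmin.
have: (2 ^+ (rk f).+1 %| pow2 f * c f)%Z.
  have -> : pow2 f * c f = - \sum_(g | g != f) pow2 g * c g.
    by apply/eqP; rewrite -addr_eq0; move/eqP: c0; rewrite (bigD1 f).
  rewrite rpredN; apply: rpred_sum => g gf.
  have [->|/fmin rg] := eqVneq (c g) 0; first by rewrite mulr0 dvdz0.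
  apply/dvdz_mulr/dvdz_exp2l; rewrite ltn_neqAle rg andbT.
  by apply: contra gf => /eqP/rk_inj->.
rewrite exprSr dvdz_mul2l ?expf_neq0 // => /dvdzP[a ca].
by have := c1 f; move: cf; rewrite ca; lia.
Qed.

(** [K] exceeds all contributions of the powers of two, and [W] those of the two lower levels
    together. On circuits [lex_weight] therefore compares first the number of edges, then [l], then
    the powers of two. *)
Let K : int := 1 + \sum_f pow2 f.
Let W : int := 1 + \sum_f (K + pow2 f).

Definition lex_weight f : int := W + K * l f + pow2 f.

Let K_gt0 : 0 < K.
Proof. by rewrite ltr_wpDr // sumr_ge0 // => f _; rewrite ltW ?pow2_gt0. Qed.

Lemma sum_lex_weight c : \sum_f lex_weight f * c f =
  W * \sum_f c f + K * \sum_f l f * c f + \sum_f pow2 f * c f.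
Proof.
rewrite !mulr_sumr -!big_split; apply: eq_bigr => f _ /=.
by rewrite /lex_weight; ring.
Qed.

Lemma norm_sum_le c (a b : E -> int) : (forall f, `|c f| <= 1) ->
  (forall f, `|a f| <= b f) -> `|\sum_f a f * c f| <= \sum_f b f.
Proof.
move=> c1 ab; apply: le_trans (ler_norm_sum _ _ _) _; apply: ler_sum => f _.
by rewrite normrM (le_trans _ (ab f)) // ler_piMr.
Qed.

Lemma sum_pow2_bound c : (forall f, `|c f| <= 1) -> `|\sum_f pow2 f * c f| < K.
Proof.
move=> c1; apply: le_lt_trans (norm_sum_le (b := pow2) c1 _) _.
  by move=> f; rewrite ger0_norm // ltW ?pow2_gt0.
by rewrite /K ltrDr.
Qed.

Lemma lex_weight_lt0 c : (forall f, `|c f| <= 1) ->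
  \sum_f c f < 0 -> \sum_f lex_weight f * c f < 0.
Proof.
move=> c1 c0; rewrite sum_lex_weight.
have: `|\sum_f (K * l f + pow2 f) * c f| < W.
  apply: le_lt_trans (norm_sum_le (b := fun f => K + pow2 f) c1 _) _.
    move=> f; apply: le_trans (ler_normD _ _) _; apply: lerD.
      by rewrite normrM gtr0_norm // ler_piMr // ltW.
    by rewrite ger0_norm // ltW ?pow2_gt0.
  by rewrite /W ltrDr.
have -> : \sum_f (K * l f + pow2 f) * c f =
    K * \sum_f l f * c f + \sum_f pow2 f * c f.
  by rewrite mulr_sumr -big_split; apply: eq_bigr => f _ /=; ring.
move: c0; rewrite -addrA; move: (_ + _) => x; move: (\sum_f c f) => y; nia.
Qed.

Lemma lex_weight_lt0_tie c : (forall f, `|c f| <= 1) ->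
  \sum_f c f = 0 -> \sum_f l f * c f < 0 -> \sum_f lex_weight f * c f < 0.
Proof.
move=> c1 c0; rewrite sum_lex_weight c0 mulr0 add0r.
have := sum_pow2_bound c1.
move: (\sum_f pow2 f * c f) => x; move: (\sum_f l f * c f) => y; nia.
Qed.

Lemma lex_weight_tie c : \sum_f c f = 0 -> \sum_f l f * c f = 0 ->
  \sum_f lex_weight f * c f = \sum_f pow2 f * c f.
Proof. by rewrite sum_lex_weight => -> ->; rewrite !mulr0 !add0r. Qed.

Lemma lex_weight_ge0 f : 0 <= lex_weight f.
Proof.
have p0 g : 0 < pow2 g := pow2_gt0 g.
rewrite addr_ge0 //; last exact: ltW.
(* This is enough because [l f] is at least -1; the summand of [f] in [W] already contains [K]. *)
have : K <= W.
  rewrite /W (bigD1 f) //=.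
  have aux (k p S : int) : 0 <= p -> 0 <= S -> k <= 1 + (k + p + S) by lia.
  apply: aux; first exact: ltW.
  by apply: sumr_ge0 => g _; rewrite addr_ge0 // ltW.
by have := l1 f; have := K_gt0; nia.
Qed.

(** Strict comparison for [c] and for its negative forces the levels to vanish one after the other;
    the last one determines [c]. *)
Lemma lex_weight_eq0 c : (forall f, `|c f| <= 1) ->
  \sum_f lex_weight f * c f = 0 -> forall f, c f = 0.
Proof.
move=> c1 w0; pose c' f := - c f.
have c'1 f : `|c' f| <= 1 by rewrite normrN.
have sumN (a : E -> int) : \sum_f a f * c' f = - \sum_f a f * c f.
  by rewrite -sumrN; apply: eq_bigr => f _; rewrite mulrN.
have w0' : \sum_f lex_weight f * c' f = 0 by rewrite sumN w0 oppr0.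
have c0 : \sum_f c f = 0.
  case: (ltgtP (\sum_f c f) 0) => // h.
    by have := lex_weight_lt0 c1 h; rewrite w0.
  have := @lex_weight_lt0 c' c'1; rewrite w0' sumrN oppr_lt0 => /(_ h).
  by rewrite ltxx.
have l0 : \sum_f l f * c f = 0.
  case: (ltgtP (\sum_f l f * c f) 0) => // h.
    by have := lex_weight_lt0_tie c1 c0 h; rewrite w0.
  have := @lex_weight_lt0_tie c' c'1; rewrite w0' sumrN c0 oppr0 sumN oppr_lt0.
  by move=> /(_ erefl h); rewrite ltxx.
by apply: sum_pow2_eq0 => //; rewrite -(lex_weight_tie c0 l0).
Qed.

Hypothesis conn : edge_connected D.

(** A cut sum weights the crossing signs -1, 0, 1 by distinct powers of two; if it is zero, no edge
    crosses [P], against connectivity. *)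
Lemma pow2_cut (P : pred V) : (exists v, P v) -> (exists v, ~~ P v) ->
  \sum_(v | P v) bd pow2 v != 0.
Proof.
move=> Pex [v nPv]; apply/eqP; rewrite sum_bd => /sum_pow2_eq0 h.
case/negP: nPv; apply: conn => // f.
have {}h g : (P (head g))%:R - (P (tail g))%:R = 0 :> int.
  by apply: h => {}g; case: (P _); case: (P _).
by have := h f; case: (P _); case: (P _).
Qed.

(** The powers of two serve twice: as last tie-breaker of the weight and as shift. *)
Definition lex_data : generic_data D :=
  @GenericData D lex_weight pow2 lex_weight_ge0
    (fun c cc => lex_weight_eq0 cc.1) (fun c cc => @lex_weight_lt0 c cc.1)
    (fun f => ltW (pow2_gt0 f)) pow2_cut.

End LexicographicData.

(** * Contraction *)

Section Contraction.
Variables (D : digraph) (e : edge D).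
Hypothesis conn : edge_connected D.
Local Notation V := (vertex D).
Local Notation E := (edge D).
Local Notation D' := (contract e).
Local Notation E' := (edge D').
Local Notation proj := (contract_proj e).

Lemma proj_endpoints : proj (head e) = proj (tail e).
Proof.
apply: val_inj; rewrite /= /contract_fun eqxx.
by case: ifP => // /eqP.
Qed.

Lemma projK (v' : vertex D') : proj (val v') = v'.
Proof.
apply: val_inj; rewrite /= /contract_fun; case: ifP => // /eqP vh.
by have := valP v'; rewrite /= vh eqxx /= => /eqP.
Qed.

Lemma contract_connected : edge_connected D'.
Proof.
move=> P [v' Pv'] Pf x'; rewrite -(projK x').
apply: (conn (P := fun v => P (proj v))); first by exists (val v'); rewrite projK.
move=> f; have [->|fe] := eqVneq f e; first by rewrite proj_endpoints.
exact: (Pf (exist _ f fe)).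
Qed.

Lemma sum_contract (F : nmodType) (a : E -> F) :
  \sum_f a f = a e + \sum_(f' : E') a (val f').
Proof. by rewrite (bigD1 e) //=; congr (_ + _); apply: big_sub. Qed.

(** Both ends of [e] lie in the same fibre, so [e] contributes to no fibre sum. *)
Lemma bd_contract (F : comPzRingType) (z : E -> F) (v' : vertex D') :
  bd (fun f' : E' => z (val f')) v' = \sum_(v | proj v == v') bd z v.
Proof.
rewrite sum_bd sum_contract proj_endpoints subrr mulr0 add0r.
by apply: eq_bigr => f' _; rewrite /incidence ![v' == _]eq_sym.
Qed.

(** The kernel of the projection: the only fibre that can have two elements consists of the ends of
    [e], where [y] takes opposite values. For a loop every fibre is a single vertex and [y] is
    zero. *)
Lemma fiber_sum_eq0 (y : V -> int) :
  (forall v', \sum_(v | proj v == v') y v = 0) ->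
  forall v, y v = y (head e) * incidence int e v.
Proof.
move=> y0 v; have fibE x : (proj x == proj v) = (contract_fun e x == contract_fun e v).
  by rewrite -val_eqE.
have := y0 (proj v); under eq_bigl do rewrite fibE; rewrite /incidence.
have [he|he] := eqVneq (head e) (tail e).
  have cfE x : contract_fun e x = x.
    by rewrite /contract_fun he; case: (eqVneq x (tail e)).
  rewrite (big_pred1 v) => [->|x]; last by rewrite /= !cfE.
  by rewrite he subrr mulr0.
have [->|vh] := eqVneq v (head e); first by rewrite (negbTE he) subr0 mulr1.
have cv : contract_fun e v = v by rewrite /contract_fun (negbTE vh).
rewrite cv /contract_fun; have [->|vt] := eqVneq v (tail e); last first.
  rewrite (big_pred1 v) => [->|x]; first by rewrite subrr mulr0.
  rewrite /=; case: (eqVneq x (head e)) => // ->.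
  by rewrite eq_sym (negbTE vt) eq_sym (negbTE vh).
rewrite (bigD1 (head e)) ?eqxx //= (big_pred1 (tail e)) => [|x].
  by rewrite /=; lia.
rewrite /=; case: (eqVneq x (head e)) => [->|_]; last by rewrite andbT.
by rewrite (negbTE he) andbF.
Qed.

(** The edge [e] receives a rank above all others, so that its share of the shift dominates. *)
Definition contract_rank (f : E) : nat := if f == e then #|E| else enum_rank f.

Lemma contract_rank_inj : injective contract_rank.
Proof.
move=> f g; rewrite /contract_rank.
have [->|_] := eqVneq f e; have [->|_] := eqVneq g e => //.
- by move=> h; have := ltn_ord (enum_rank g); rewrite -h ltnn.
- by move=> h; have := ltn_ord (enum_rank f); rewrite h ltnn.
- by move/val_inj/enum_rank_inj.
Qed.

(* Pulling e: among flows with equally many edges, those using e are preferred.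
   The conservation law at [head e] expresses the multiplicity of e in a
   circuit of D through the contracted circuit. *)
Definition pull_weight (f : E) : int := - (f == e)%:R.
Definition contract_weight (f' : E') : int := - incidence int (val f') (head e).

Lemma pull_weight_le1 f : `|pull_weight f| <= 1.
Proof. by rewrite /pull_weight; case: eqP. Qed.

Lemma contract_weight_le1 f' : `|contract_weight f'| <= 1.
Proof.
by rewrite /contract_weight /incidence; case: eqP => _; case: eqP.
Qed.

Let G : generic_data D := lex_data pull_weight_le1 contract_rank_inj conn.
Let G' : generic_data D' := lex_data contract_weight_le1
  (inj_comp contract_rank_inj val_inj) contract_connected.

(** A loop [e] is left out, since an independent set contains no loop. *)
Definition lift_edges (s' : {set E'}) : {set E} :=
  [set val f' | f' in s'] :|: [set f | (f == e) && (head e != tail e)].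

Lemma mem_lift_edges s' (f' : E') : (val f' \in lift_edges s') = (f' \in s').
Proof.
by rewrite !inE (mem_imset _ _ val_inj) (negbTE (valP f')) orbF.
Qed.

Lemma mem_lift_edges_e s' : (e \in lift_edges s') = (head e != tail e).
Proof.
rewrite !inE eqxx; case: imsetP => // -[f' _ ef'].
by have := valP f'; rewrite -ef' eqxx.
Qed.

Lemma lift_edges_inj : injective lift_edges.
Proof. by move=> s t st; apply/setP => f'; rewrite -!mem_lift_edges st. Qed.

Lemma edge_split (P : E -> Prop) :
  P e -> (forall f' : E', P (val f')) -> forall f, P f.
Proof.
move=> Pe PE' f; have [->//|fe] := eqVneq f e.
exact: (PE' (exist _ f fe)).
Qed.

Lemma supported_lift (F : nmodType) s' (z : E -> F) :
  supported (lift_edges s') z -> supported s' (fun f' : E' => z (val f')).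
Proof. by move=> zs f' fs'; apply: zs; rewrite mem_lift_edges. Qed.

(** A violating circuit [c] of D is restricted to a circuit [c'] of D/e, and the levels of the two
    weights are compared until one shows that [c'] violates optimality of [s']. *)
Lemma lift_optimal s' : optimal (weight G') s' -> optimal (weight G) (lift_edges s').
Proof.
move=> opt' c [c1 c0] cs; rewrite leNgt; apply/negP => wc.
pose c' (f' : E') := c (val f').
have c'1 f' : `|c' f'| <= 1 by exact: c1.
have c'0 v' : bd c' v' = 0 by rewrite bd_contract big1.
have := opt' c' (conj c'1 c'0).
have c's f' : f' \notin s' -> 0 <= c' f'.
  by move=> fs'; apply: cs; rewrite mem_lift_edges.
move=> /(_ c's); rewrite leNgt => /negP; apply.
have sumc : \sum_f c f = c e + \sum_f' c' f' := sum_contract c.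
have lc : \sum_f pull_weight f * c f = - c e.
  rewrite sum_contract /pull_weight eqxx mulN1r big1 ?addr0 // => f' _.
  by rewrite (negbTE (valP f')) oppr0 mul0r.
have lc' : \sum_f' contract_weight f' * c' f' = c e * incidence int e (head e).
  have := c0 (head e); rewrite /bd sum_contract => /eqP.
  rewrite addr_eq0 => /eqP ->; rewrite -sumrN; apply: eq_bigr => f' _.
  by rewrite /contract_weight /c' mulNr mulrC.
have ce_loop : head e = tail e -> 0 <= c e.
  by move=> he; apply: cs; rewrite mem_lift_edges_e he eqxx.
have inc1 : head e != tail e -> incidence int e (head e) = 1.
  by move=> he; rewrite /incidence eqxx (negbTE he) subr0.
have cN1 f : `|- c f| <= 1 by rewrite normrN.
have wcN : ~ (\sum_f lex_weight pull_weight contract_rank f * (- c f) < 0).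
  by rewrite -[X in ~ (X < 0)]opprK -sumrN; under eq_bigr do rewrite mulrN opprK;
     rewrite oppr_lt0 => h; move: (lt_trans h wc); rewrite ltxx.
have sumc_le0 : \sum_f c f <= 0.
  rewrite leNgt; apply/negP => h; apply: wcN; apply: lex_weight_lt0 => //.
    exact: pull_weight_le1.
  by rewrite sumrN oppr_lt0.
pose rk' (f' : E') := contract_rank (val f').
have lt1 := lex_weight_lt0 rk' contract_weight_le1 c'1.
have lt2 := @lex_weight_lt0_tie D' contract_weight rk' c' c'1.
have [h|h|h] := ltgtP (\sum_f' c' f') 0; first exact: lt1.
  (* Here [c] has edge sum zero, and its pulling level [- c e] is 1, which would make the weight of
     [c] positive. *)
  have ce : c e = -1.
    have := c1 e; move: sumc sumc_le0 h.
    move: (\sum_f c f) (\sum_f' c' f'); lia.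
  have sc0 : \sum_f c f = 0.
    have := c1 e; move: sumc sumc_le0 h.
    move: (\sum_f c f) (\sum_f' c' f'); lia.
  case: wcN; apply: lex_weight_lt0_tie => //.
    by rewrite sumrN sc0 oppr0.
  by under eq_bigr do rewrite mulrN; rewrite sumrN lc ce.
have ce : c e <= 0.
  move: sumc sumc_le0 h.
  move: (\sum_f c f) (\sum_f' c' f'); lia.
(* If [c e = -1], then [e] is not a loop, as a loop lies outside the lifted set; the second level of
   [c'] equals [c e] and is negative. *)
have [ce0|ce0] := eqVneq (c e) 0; last first.
  have ceN : c e = -1 by have := c1 e; lia.
  apply: lt2 => //; rewrite lc' inc1 ?ceN //.
  by apply/eqP => /ce_loop; rewrite ceN.
(* The upper two levels vanish for both circuits, and the powers of two agree because D/e inherits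
   its ranks. *)
have sc0 : \sum_f c f = 0 by rewrite sumc ce0 add0r.
suff: \sum_f' lex_weight contract_weight rk' f' * c' f' < 0 by [].
rewrite lex_weight_tie // ?lc' ?ce0 ?mul0r //.
move: wc; rewrite /= lex_weight_tie ?lc ?ce0 ?oppr0 //.
by rewrite sum_contract ce0 mulr0 add0r.
Qed.

(** Expand an edge of D/e over [s'] and lift the coefficients with 0 at [e]. The error has zero
    fibre sums, so it is a multiple of the vector of [e]. *)
Lemma lift_spanning s' : spanning s' -> spanning (lift_edges s').
Proof.
move=> span'; apply: edge_split.
  have [he|he] := eqVneq (head e) (tail e); last first.
    by apply: spanned_incidence; rewrite mem_lift_edges_e.
  by exists (fun=> 0) => // v; rewrite bd0 /incidence he subrr.
move=> f'; have [z' zs' zf'] := span' f'.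
pose z f := if insub f is Some g' then z' g' else 0.
have zE (g' : E') : z (val g') = z' g' by rewrite /z valK.
have ze : z e = 0 by rewrite /z insubF // eqxx.
pose y v := incidence int (val f') v - bd z v.
have yE : forall v, y v = y (head e) * incidence int e v.
  apply: fiber_sum_eq0 => v'; rewrite sumrB sum_incidence -bd_contract.
  rewrite (eq_bd (z' := z')) // zf' /incidence.
  by rewrite ![v' == _]eq_sym subrr.
exists (fun f => z f + if f == e then y (head e) else 0); last first.
  by move=> v; rewrite bdD bd_single -yE /y addrC subrK.
(* If [e] is outside the lifted set, it is a loop, and then the correction [y (head e)] is zero. *)
apply: edge_split => [|g' gs'].
  rewrite mem_lift_edges_e negbK ze eqxx add0r => /eqP he.
  by rewrite yE /incidence he subrr mulr0.
by rewrite zE zs' ?(negbTE (valP g')) ?addr0 // -mem_lift_edges.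
Qed.

Lemma lift_bases s' : s' \in bases G' -> lift_edges s' \in bases G.
Proof.
move=> /basesP[opt' span']; apply/basesP; split; first exact: lift_optimal.
exact: lift_spanning.
Qed.

(** The powers of two below the rank of [e] add up to one less than its own power. *)
Lemma shift_e_gt : \sum_(f' : E') shift G (val f') < shift G e.
Proof.
have -> : shift G e = 2 ^+ #|E| by rewrite /= /pow2 /contract_rank eqxx.
have sumE : \sum_(f : E) 2 ^+ enum_rank f = 2 ^+ #|E| - 1 :> int.
  by rewrite subrX1 mul1r (reindex (@enum_rank E)) //; apply: onW_bij; exact: enum_rank_bij.
apply: (@le_lt_trans _ _ (\sum_(f : E) 2 ^+ enum_rank f)); last first.
  by rewrite sumE ltrBlDr ltrDl.
rewrite sum_contract; apply: ler_wpDl; first exact: exprn_ge0.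
apply: ler_sum => f' _ /=.
by rewrite /pow2 /contract_rank (negbTE (valP f')).
Qed.

(** The coordinate at [e] is the sum of [q] over a cut that [e] enters, and the shift of [e]
    outweighs all other edges. Hence [e] is never excluded. *)
Lemma lift_coords_e_gt0 s' : s' \in bases G' -> head e != tail e ->
  0 < coords G (lift_edges s') e.
Proof.
move=> /lift_bases sb he; have [rs rq] := coordsP sb.
have eL : e \in lift_edges s' by rewrite mem_lift_edges_e.
have [P [Ph Pt Pz]] := fundamental_cut (bases_independent sb) eL.
rewrite -(Pz _ rs); under eq_bigr do rewrite rq.
rewrite sum_bd sum_contract Ph (negbTE Pt) subr0 mulr1.
rewrite -[X in _ + X]opprK subr_gt0; apply: le_lt_trans shift_e_gt.
rewrite -sumrN; apply: ler_sum => f' _.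
have := shift_ge0 G (val f'); case: (P _); case: (P _) => /=; lia.
Qed.

(** The shift of D/e is the restriction of that of D, so restricting the expansion of [q] gives an
    expansion over [s'], which is unique. *)
Lemma lift_coords s' (f' : E') : s' \in bases G' ->
  coords G (lift_edges s') (val f') = coords G' s' f'.
Proof.
move=> sb'; have [rs rq] := coordsP (lift_bases sb'); have [rs' rq'] := coordsP sb'.
have := independent_inj (bases_independent sb') (supported_lift rs) rs'.
apply=> v'; rewrite rq' bd_contract.
under eq_bigr do rewrite rq.
by rewrite -bd_contract.
Qed.

Lemma card_excluded_lift s' : s' \in bases G' ->
  #|excluded G (lift_edges s')| = #|excluded G' s'|.
Proof.
move=> sb'; rewrite -(card_imset _ val_inj); apply: eq_card.
apply: edge_split => [|f'].
  rewrite inE mem_lift_edges_e; case: imsetP => [[f' _ ef']|_].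
    by have := valP f'; rewrite -ef' eqxx.
  apply/negP => /andP[/(lift_coords_e_gt0 sb') h]; rewrite ltNge.
  by rewrite (ltW h).
rewrite (mem_imset _ _ val_inj) finset.in_set mem_lift_edges lift_coords //.
by rewrite finset.in_set.
Qed.

Lemma contract_bases_count (i : nat) :
  (#|[set s' in bases G' | #|excluded G' s'| == i]|
   <= #|[set s in bases G | #|excluded G s| == i]|)%N.
Proof.
rewrite -(card_imset _ lift_edges_inj); apply: subset_leq_card.
apply/fintype.subsetP => _ /imsetP[s' + ->].
move=> /finset.setIdP[sb' /eqP si]; apply/finset.setIdP.
by rewrite card_excluded_lift // si; split; first exact: lift_bases.
Qed.

Lemma card_lift_ge (s' : {set E'}) : (#|s'| <= #|lift_edges s'|)%N.
Proof.
rewrite -(card_imset _ val_inj); apply: subset_leq_card; exact: finset.subsetUl.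
Qed.

Lemma hstar_contract_le (R : realType) (u : V) (i : nat) :
  (hstar_digraph R (contract e))`_i <= (hstar_digraph R D)`_i.
Proof.
(* The decomposition applied to the zero flow provides a basis of D/e, through which both
   coefficients are expressed. *)
have [s' [_ [sb' _ _ _ _]]] := half_open_exists G' (x := fun=> 0) (fun=> lexx 0).
rewrite (hstar_digraph_coef (D := D') R (proj u) contract_connected _ sb').
rewrite (hstar_digraph_coef R u conn _ (lift_bases sb')).
(* Above the degree bound of D/e the left side is 0 and the right side is a count or 0. *)
case: (leqP i #|s'|) => [h|_]; last by case: ifP.
by rewrite (leq_trans h (card_lift_ge s')) ler_nat contract_bases_count.
Qed.

End Contraction.

Lemma weakly_connected_edge_connected (D : digraph) :
  weakly_connected D -> edge_connected D.
Proof.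
case=> _ conn P [u Pu] Pf v.
have cl : closed (@adjacent D) P.
  move=> x y /existsP[f /orP[]] /andP[/eqP<- /eqP<-]; have := Pf f;
  by rewrite /in_mem /= => ->.
by have := closed_connect cl (conn u v); rewrite /in_mem /= Pu.
Qed.

Theorem theorem1p2 (R : realType) (D : digraph) (hD : weakly_connected D)
    (e : edge D) :
  forall i : nat, (hstar_digraph R (contract e))`_i <= (hstar_digraph R D)`_i.
Proof.
move=> i; have /card_gt0P[u _] := hD.1.
exact: hstar_contract_le (weakly_connected_edge_connected hD) R u i.
Qed.
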